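(* Let $\beta\in(1,\frac{1+\sqrt5}{2})$. Then for every $x\in(-\frac{1}{\beta-1},\frac{1}{\beta-1})$ there exists $(\epsilon_i)_{i\ge1}\in\{-1,1\}^{\mathbb{N}}$ such that $$x=\sum_{i=1}^{\infty}\frac{\epsilon_i}{\beta^i}\quad\text{and}\quad x=\lim_{n\to\infty}\frac{1}{n^{1/2}}\sum_{i=1}^{n}\epsilon_i.$$
   Context: No non-standard notation is used. *)

(* Defs.v *)
From Stdlib Require Import Reals.
From Coquelicot Require Import Coquelicot.
Open Scope R_scope.

(* A sequence (eps_i)_{i >= 1} of signs; the value at index 0 is unused. *)
Definition sign_sequence (eps : nat -> R) : Prop :=
  forall i : nat, (1 <= i)%nat -> eps i = -1 \/ eps i = 1.

(* Main.v *)
Require Import Defs.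
From Stdlib Require Import Reals Lra Psatz.
From Coquelicot Require Import Coquelicot.
Open Scope R_scope.

(** Digits [d_1, d_2, ...] expand [x] exactly when the orbit [y_0 = x],
    [y_(n+1) = beta y_n - d_(n+1)] stays bounded, since
    [y_n = beta^n (x - d_1/beta - ... - d_n/beta^n)].  The recursion also gives
    [S_n + y_n = x + (beta - 1) (y_0 + ... + y_(n-1))] for the digit sums [S_n].
    So the digit sum is steered, up to a bounded error, by keeping the orbit
    high or low on average.

    The lazy rule with threshold [t] takes the digit -1 as long as [y < t], and
    thus pushes the orbit up.  The borderline is [t = 1/(beta+1)], where the
    rule follows the 2-cycle between [1/(beta+1)] and [-1/(beta+1)], whose
    average is 0.  For a larger [t] the orbit ends up above [-1/(beta+1)], and
    a negative point [y] there is outweighed by its successor, because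
    [y + (beta y + 1) > 0]; so the drift is positive.  The orbit
    remains inside a compact part of [(-1/(beta-1), 1/(beta-1))] provided that
    [beta t + 1 < 1/(beta-1)].  The two demands on [t] are compatible precisely
    when [beta] is below the golden ratio ([steering_constants]).
    The drift is made uniform, in every single step and from every point of the
    compact interval, by adding a bounded correction [potential] to the sum
    ([potential_drift]).  The mirrored rule has a uniform negative drift.

    Using the lazy rule when [S_n + y_n] is at most a target [f n] and the
    mirrored rule when it exceeds the target keeps [S_n - f n] bounded for each
    slowly varying [f] ([steered_expansion]).  For the limit at hand the target
    is [f n = x sqrt (n + N)]: a large [N] makes it vary as slowly as required,
    and changes [x sqrt n] only by a bounded amount. *)

(** * The lazy rule and its drift *)

Definition lazy_digit (t y : R) : R := if Rlt_dec y t then -1 else 1.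

Definition lazy_step (beta t y : R) : R := beta * y - lazy_digit t y.

Lemma lazy_digit_sign (t y : R) : lazy_digit t y = -1 \/ lazy_digit t y = 1.
Proof. unfold lazy_digit; destruct (Rlt_dec y t); auto. Qed.

Lemma lazy_step_bounded (beta t B y : R) :
  1 < beta -> 0 <= t -> beta * t + 1 <= B -> (beta - 1) * B <= 1 ->
  - B <= y <= B -> - B <= lazy_step beta t y <= B.
Proof.
intros hb ht htB hB hy; unfold lazy_step, lazy_digit.
destruct (Rlt_dec y t); split; nra.
Qed.

(** The three pieces serve three regions.  Above [delta] the point [y] itself
    is gain enough and no correction is needed.  Between [-1/(beta+1)] and
    [delta] the slope 1 postpones the small or negative value of [y] to the
    next, large point.  Below [-1/(beta+1)], where the orbit may linger while
    it moves away from [-1/(beta-1)], the steep slope [a] rewards this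
    upward motion. *)
Definition potential (beta delta a y : R) : R :=
  Rmin (Rmin 0 (y - delta)) (a * (y + / (beta + 1))).

Lemma potential_cases (beta delta a y : R) :
  let g := potential beta delta a y in
  (g <= 0 /\ g <= y - delta /\ g <= a * (y + / (beta + 1))) /\
  (g = 0 \/ g = y - delta \/ g = a * (y + / (beta + 1))).
Proof.
unfold potential, Rmin.
destruct (Rle_dec 0 (y - delta)); destruct (Rle_dec _ (a * _)); split; lra.
Qed.

Lemma potential_bounded (beta delta a B y : R) :
  0 < beta -> 0 <= delta -> 0 <= a -> - B <= y <= B ->
  Rabs (potential beta delta a y) <= B + delta + a * B.
Proof.
intros hb hd ha hy.
assert (hq : 0 < / (beta + 1)) by (apply Rinv_0_lt_compat; lra).
destruct (potential_cases beta delta a y) as [[h1 [h2 h3]] h].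
set (g := potential beta delta a y) in *.
apply Rabs_le; split; [|nra].
destruct h as [h|[h|h]]; rewrite h; nra.
Qed.

Lemma potential_drift (beta t B delta a y : R) :
  let q := / (beta + 1) in
  1 < beta -> 0 < delta -> 2 * delta <= q -> 2 * delta <= (beta + 1) * t - 1 ->
  0 <= a -> B + delta <= a * (1 - (beta - 1) * B) ->
  5 * beta + 1 <= a ->
  - B <= y ->
  delta <= y + potential beta delta a (lazy_step beta t y)
             - potential beta delta a y.
Proof.
intros q hb hd hdq hdt ha0 ha ha' hy.
assert (hq : (beta + 1) * q = 1) by (unfold q; field; lra).
assert (hqt : q < t) by nra.
assert (hq1 : q <= 1) by nra.
destruct (potential_cases beta delta a y) as [[h1 [h2 h3]] _].
destruct (potential_cases beta delta a (lazy_step beta t y)) as [_ k].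
fold q in h3, k.
set (g := potential beta delta a y) in *.
set (g' := potential beta delta a (lazy_step beta t y)) in *.
unfold lazy_step, lazy_digit in k.
destruct (Rlt_dec y t) as [hyt|hyt].
- destruct k as [k|[k|k]]; rewrite k.
  + lra.
  + (* Either the next point already exceeds [delta], or [y] is so far below
       [-1/(beta+1)] that the steep piece of the potential pays. *)
    destruct (Rle_dec delta (beta * y + 1)) as [hl|hl]; [lra|].
    assert (hz : 2 * beta * (y + q) <= - q) by nra.
    assert (hz' : (a - (beta + 1)) * (y + q) <= 4 * beta * (y + q)) by nra.
    nra.
  + assert (hB : a * (1 - (beta - 1) * B) <= a * ((beta - 1) * y + 1))
      by (apply Rmult_le_compat_l; nra).
    nra.
- destruct k as [k|[k|k]]; rewrite k.
  + lra.
  + nra.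
  + assert (0 <= beta * y - 1 + q) by nra.
    nra.
Qed.

(** The inequality [1/(beta+1) < (2-beta)/(beta(beta-1))], equivalent to
    [beta^2 < beta + 1], leaves room for the threshold. *)
Lemma steering_constants (beta x : R) :
  1 < beta < (1 + sqrt 5) / 2 ->
  - (1 / (beta - 1)) < x < 1 / (beta - 1) ->
  exists t B : R,
    1 < (beta + 1) * t /\ beta * t + 1 <= B /\ (beta - 1) * B < 1 /\
    - B <= x <= B.
Proof.
intros [hb hgold] hx.
assert (h5 : sqrt 5 * sqrt 5 = 5) by (apply sqrt_sqrt; lra).
assert (h5p : 0 <= sqrt 5) by apply sqrt_pos.
assert (hb2 : beta * beta < beta + 1) by nra.
set (q := / (beta + 1)).
set (s := (2 - beta) / (beta * (beta - 1))).
assert (hq : (beta + 1) * q = 1) by (unfold q; field; lra).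
assert (hs : beta * (beta - 1) * s = 2 - beta) by (unfold s; field; lra).
assert (hqs : q < s).
{ assert (h : 0 < beta * (beta - 1) * (beta + 1)) by
    (repeat apply Rmult_lt_0_compat; lra).
  apply (Rmult_lt_reg_l _ _ _ h).
  replace (beta * (beta - 1) * (beta + 1) * q)
    with (beta * (beta - 1) * ((beta + 1) * q)) by ring.
  replace (beta * (beta - 1) * (beta + 1) * s)
    with ((beta * (beta - 1) * s) * (beta + 1)) by ring.
  rewrite hq, hs; nra. }
exists ((q + s) / 2), (Rmax (Rabs x) (beta * ((q + s) / 2) + 1)).
assert (hxa : (beta - 1) * Rabs x < 1).
{ assert (hr : (beta - 1) * (1 / (beta - 1)) = 1) by (field; lra).
  assert (Rabs x < 1 / (beta - 1)) by (apply Rabs_def1; lra).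
  nra. }
assert (hab := proj1 (Rabs_le_between x (Rabs x)) (Rle_refl _)).
assert (hl := Rmax_l (Rabs x) (beta * ((q + s) / 2) + 1)).
assert (hr := Rmax_r (Rabs x) (beta * ((q + s) / 2) + 1)).
repeat split; try lra; try nra.
unfold Rmax; destruct (Rle_dec _ _); [|lra].
assert (beta * (beta - 1) * q < beta * (beta - 1) * s)
  by (apply Rmult_lt_compat_l; nra).
nra.
Qed.

(** * Steering the digit sum along a target *)

(** The state is the pair of the orbit point [y] and the digit sum [s]; [c] is
    the current value of the target. *)
Definition steered_digit (t c : R) (ys : R * R) : R :=
  if Rle_dec (snd ys + fst ys) c then lazy_digit t (fst ys)
  else - lazy_digit t (- fst ys).

Fixpoint steered_state (beta t x : R) (f : nat -> R) (n : nat) : R * R :=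
  match n with
  | O => (x, 0)
  | S m => let ys := steered_state beta t x f m in
           let d := steered_digit t (f m) ys in
           (beta * fst ys - d, snd ys + d)
  end.

(** Above 0 a step loses at most [C], and below 0 the corrected value [E + h]
    cannot decrease, so that it never gets below a fixed level. *)
Lemma bounded_below_of_drift (E h : nat -> R) (C G : R) :
  (forall n, Rabs (h n) <= G) ->
  (forall n, E n - C <= E (S n)) ->
  (forall n, E n < 0 -> E n + h n <= E (S n) + h (S n)) ->
  exists A, forall n, - A <= E n.
Proof.
intros hG hC hup.
set (A := Rmax (C + G) (G - E O)).
assert (hA1 : C + G <= A) by apply Rmax_l.
assert (hA2 : G - E O <= A) by apply Rmax_r.
assert (hb : forall n, - G <= h n <= G)
  by (intros n; apply Rabs_le_between, hG).
assert (inv : forall n, - A <= E n + h n).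
{ induction n as [|n IH].
  - specialize (hb O); lra.
  - destruct (Rlt_dec (E n) 0) as [hn|hn].
    + specialize (hup n hn); lra.
    + specialize (hC n); specialize (hb (S n)); lra. }
exists (A + G); intros n; specialize (inv n); specialize (hb n); lra.
Qed.

(** Unrolling [y_(n+1) = beta y_n - d_(n+1)] expresses the remainder of the
    expansion as [y_n / beta^n], which tends to 0 for a bounded orbit. *)
Lemma is_series_of_bounded_orbit (beta B : R) (y d : nat -> R) :
  1 < beta ->
  (forall n, y (S n) = beta * y n - d (S n)) ->
  (forall n, - B <= y n <= B) ->
  is_series (fun k => d (S k) / beta ^ (S k)) (y O).
Proof.
intros hb hy hB.
assert (hpow : forall n, 0 < beta ^ n) by (intros n; apply pow_lt; lra).
assert (hsum : forall n,
  sum_n (fun k => d (S k) / beta ^ (S k)) n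
  = y O - y (S n) * (/ beta) ^ (S n)).
{ induction n as [|n IH].
  - rewrite sum_O, hy; simpl; field; lra.
  - rewrite sum_Sn, IH, (hy (S n)); unfold plus; simpl.
    rewrite !pow_inv; field; split; [|lra].
    specialize (hpow n); lra. }
change (is_lim_seq (sum_n (fun k => d (S k) / beta ^ (S k))) (y O)).
apply is_lim_seq_ext with (fun n => y O - y (S n) * (/ beta) ^ (S n));
  [intros n; symmetry; apply hsum|].
assert (hz : is_lim_seq (fun n => B * (/ beta) ^ (S n)) 0).
{ replace (Finite 0) with (Rbar_mult B 0) by (simpl; f_equal; ring).
  apply is_lim_seq_scal_l.
  apply (is_lim_seq_incr_1 (fun n => (/ beta) ^ n)).
  apply is_lim_seq_geom.
  rewrite Rabs_pos_eq; [rewrite <- Rinv_1; apply Rinv_lt_contravar; lra|].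
  left; apply Rinv_0_lt_compat; lra. }
assert (hz' : is_lim_seq (fun n => y (S n) * (/ beta) ^ (S n)) 0).
{ apply is_lim_seq_abs_0.
  apply is_lim_seq_le_le with (u := fun _ => 0)
    (w := fun n => B * (/ beta) ^ (S n)); [|apply is_lim_seq_const|exact hz].
  intros n; split; [apply Rabs_pos|].
  assert (hp : 0 < (/ beta) ^ (S n))
    by (apply pow_lt, Rinv_0_lt_compat; lra).
  rewrite Rabs_mult, (Rabs_pos_eq ((/ beta) ^ (S n))) by lra.
  apply Rmult_le_compat_r; [lra|].
  apply Rabs_le, hB. }
replace (Finite (y O)) with (Finite (y O - 0)) by (f_equal; ring).
apply is_lim_seq_minus'; [apply is_lim_seq_const|exact hz'].
Qed.

Theorem steered_expansion (beta x : R) :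
  1 < beta < (1 + sqrt 5) / 2 ->
  - (1 / (beta - 1)) < x < 1 / (beta - 1) ->
  exists c : R, 0 < c /\
    forall f : nat -> R, (forall n, Rabs (f (S n) - f n) <= c) ->
    exists (eps : nat -> R) (A : R),
      sign_sequence eps /\
      is_series (fun k : nat => eps (S k) / beta ^ (S k)) x /\
      forall n, Rabs (sum_n_m eps 1 n - f n) <= A.
Proof.
intros hbeta hx.
destruct (steering_constants beta x hbeta hx) as [t [B [ht [htB [hB hxB]]]]].
destruct hbeta as [hb _].
set (q := / (beta + 1)).
assert (hq : 0 < q) by (apply Rinv_0_lt_compat; lra).
set (delta := Rmin (q / 2) (((beta + 1) * t - 1) / 2)).
assert (hd1 : delta <= q / 2) by apply Rmin_l.
assert (hd2 : delta <= ((beta + 1) * t - 1) / 2) by apply Rmin_r.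
assert (hd : 0 < delta) by (apply Rmin_glb_lt; lra).
set (a := Rmax ((B + delta) / (1 - (beta - 1) * B)) (5 * beta + 1)).
assert (ha1 : 5 * beta + 1 <= a) by apply Rmax_r.
assert (ha2 : B + delta <= a * (1 - (beta - 1) * B)).
{ apply Rle_div_l; [lra|apply Rmax_l]. }
assert (ht0 : 0 <= t) by nra.
set (g := potential beta delta a).
assert (hdrift : forall y, - B <= y ->
  delta <= y + g (lazy_step beta t y) - g y).
{ intros y hy; apply (potential_drift beta t B delta a y); fold q; lra. }
exists ((beta - 1) * delta); split; [nra|].
intros f hf.
set (st := steered_state beta t x f).
set (d := fun n => steered_digit t (f n) (st n)).
set (eps := fun n => d (pred n)).
assert (hst : forall n,
  st (S n) = (beta * fst (st n) - d n, snd (st n) + d n)) by reflexivity.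
assert (hdig : forall n,
  (snd (st n) + fst (st n) <= f n /\
     fst (st (S n)) = lazy_step beta t (fst (st n))) \/
  (f n < snd (st n) + fst (st n) /\
     - fst (st (S n)) = lazy_step beta t (- fst (st n)))).
{ intros n; rewrite hst; unfold lazy_step, d, steered_digit; cbn [fst].
  destruct (Rle_dec _ _); [left|right]; split; lra. }
assert (hyB : forall n, - B <= fst (st n) <= B).
{ induction n as [|n IH]; [exact hxB|].
  destruct (hdig n) as [[_ h]|[_ h]].
  - rewrite h; apply lazy_step_bounded; lra.
  - assert (k := lazy_step_bounded beta t B (- fst (st n))
               hb ht0 htB (Rlt_le _ _ hB) ltac:(lra)).
    rewrite <- h in k; lra. }
assert (hsum : forall n, sum_n_m eps 1 n = snd (st n)).
{ induction n as [|n IH].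
  - rewrite sum_n_m_zero; [reflexivity|auto].
  - rewrite sum_n_Sm, IH, hst by auto with arith; reflexivity. }
set (E := fun n => snd (st n) + fst (st n) - f n).
assert (hE : forall n,
  E (S n) - E n = (beta - 1) * fst (st n) - (f (S n) - f n)).
{ intros n; unfold E; rewrite hst; cbn [fst snd]; ring. }
assert (hf' : forall n,
  - ((beta - 1) * delta) <= f (S n) - f n <= (beta - 1) * delta)
  by (intros n; apply Rabs_le_between, hf).
set (G := (beta - 1) * (B + delta + a * B)).
assert (hg : forall y, - B <= y <= B -> Rabs ((beta - 1) * g y) <= G).
{ intros y hy; rewrite Rabs_mult, (Rabs_pos_eq (beta - 1)) by lra.
  apply Rmult_le_compat_l; [lra|].
  apply potential_bounded; lra. }
destruct (bounded_below_of_drift E (fun n => (beta - 1) * g (fst (st n)))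
            ((beta - 1) * B + (beta - 1) * delta) G) as [A1 hA1].
{ intros n; apply hg, hyB. }
{ intros n; specialize (hE n); specialize (hf' n); specialize (hyB n); nra. }
{ intros n hn; specialize (hE n); specialize (hf' n); specialize (hyB n).
  destruct (hdig n) as [[_ h]|[h _]]; [|unfold E in hn; lra].
  specialize (hdrift (fst (st n)) (proj1 hyB)); rewrite <- h in hdrift; nra. }
destruct (bounded_below_of_drift (fun n => - E n)
            (fun n => (beta - 1) * g (- fst (st n)))
            ((beta - 1) * B + (beta - 1) * delta) G) as [A2 hA2].
{ intros n; apply hg; specialize (hyB n); lra. }
{ intros n; specialize (hE n); specialize (hf' n); specialize (hyB n); nra. }
{ intros n hn; specialize (hE n); specialize (hf' n); specialize (hyB n).
  destruct (hdig n) as [[h _]|[_ h]]; [unfold E in hn; lra|].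
  specialize (hdrift (- fst (st n)) ltac:(lra)).
  rewrite <- h in hdrift; nra. }
exists eps, (Rmax A1 A2 + B); split; [|split].
- intros i _; unfold eps, d, steered_digit.
  destruct (Rle_dec _ _); [apply lazy_digit_sign|].
  destruct (lazy_digit_sign t (- fst (st (pred i)))) as [h|h]; rewrite h; lra.
- apply (is_series_of_bounded_orbit beta B (fun n => fst (st n)) eps hb).
  + intros n; rewrite hst; reflexivity.
  + exact hyB.
- intros n; rewrite hsum.
  specialize (hA1 n); specialize (hA2 n); specialize (hyB n).
  unfold E in hA1, hA2.
  assert (h1 := Rmax_l A1 A2); assert (h2 := Rmax_r A1 A2).
  apply Rabs_le; lra.
Qed.

(** * Square root targets *)

Lemma sqrt_increment (r : R) : 0 < r -> 0 <= sqrt (r + 1) - sqrt r <= / sqrt r.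
Proof.
intros hr.
assert (h0 := sqrt_lt_R0 r hr).
assert (h1 := sqrt_sqrt r (Rlt_le _ _ hr)).
assert (h2 := sqrt_sqrt (r + 1) ltac:(lra)).
assert (h3 : sqrt r <= sqrt (r + 1)) by (apply sqrt_le_1; lra).
split; [lra|].
apply (Rmult_le_reg_l (sqrt r)); [exact h0|].
rewrite Rinv_r by lra; nra.
Qed.

Lemma sqrt_shift (r s : R) :
  0 <= r -> 0 <= s -> 0 <= sqrt (r + s) - sqrt r <= sqrt s.
Proof.
intros hr hs.
assert (h0 := sqrt_pos r); assert (h0' := sqrt_pos s).
assert (h1 := sqrt_sqrt r hr); assert (h1' := sqrt_sqrt s hs).
assert (h2 := sqrt_sqrt (r + s) ltac:(lra)).
assert (h3 : sqrt r <= sqrt (r + s)) by (apply sqrt_le_1; lra).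
split; [lra|nra].
Qed.

Lemma is_lim_seq_inv_sqrt : is_lim_seq (fun n => / sqrt (INR n)) 0.
Proof.
change (Finite 0) with (Rbar_inv p_infty).
apply is_lim_seq_inv; [|discriminate].
apply (filterlim_comp _ _ _ INR sqrt _ (Rbar_locally p_infty));
  [apply is_lim_seq_INR|apply filterlim_sqrt_p].
Qed.

Theorem corollary2p6 (beta : R) (hbeta : 1 < beta < (1 + sqrt 5) / 2)
    (x : R) (hx : - (1 / (beta - 1)) < x < 1 / (beta - 1)) :
  exists eps : nat -> R,
    sign_sequence eps /\
    is_series (fun k : nat => eps (S k) / beta ^ (S k)) x /\
    is_lim_seq (fun n : nat => 1 / sqrt (INR n) * sum_n_m eps 1 n) x.
Proof.
destruct (steered_expansion beta x hbeta hx) as [c [hc hsteer]].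
set (w := Rabs x / c + 1).
assert (hw : 0 < w).
{ assert (0 <= Rabs x / c)
    by (apply Rdiv_le_0_compat; [apply Rabs_pos|lra]).
  unfold w; lra. }
set (N := w * w).
assert (hN : 0 < N) by (unfold N; nra).
assert (hsN : sqrt N = w) by (apply sqrt_square; lra).
assert (hxw : Rabs x * / w <= c).
{ apply (Rmult_le_reg_r w); [lra|].
  rewrite Rmult_assoc, Rinv_l by lra.
  unfold w; replace (c * (Rabs x / c + 1)) with (Rabs x + c) by (field; lra).
  lra. }
destruct (hsteer (fun n => x * sqrt (INR n + N))) as [eps [A [he [hser hA]]]].
{ intros n.
  assert (hn := pos_INR n).
  replace (INR (S n) + N) with (INR n + N + 1) by (rewrite S_INR; ring).
  rewrite <- Rmult_minus_distr_l, Rabs_mult.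
  destruct (sqrt_increment (INR n + N) ltac:(lra)) as [h1 h2].
  rewrite (Rabs_pos_eq (_ - _)) by exact h1.
  apply Rle_trans with (2 := hxw).
  apply Rmult_le_compat_l; [apply Rabs_pos|].
  apply Rle_trans with (1 := h2).
  apply Rinv_le_contravar; [exact hw|].
  rewrite <- hsN; apply sqrt_le_1; lra. }
exists eps; split; [exact he|split; [exact hser|]].
set (D := A + Rabs x * w).
assert (hD : forall n, Rabs (sum_n_m eps 1 n - x * sqrt (INR n)) <= D).
{ intros n; specialize (hA n); cbv beta in hA.
  destruct (sqrt_shift (INR n) N (pos_INR n) (Rlt_le _ _ hN)) as [h1 h2].
  replace (sum_n_m eps 1 n - x * sqrt (INR n)) with
    ((sum_n_m eps 1 n - x * sqrt (INR n + N))
     + x * (sqrt (INR n + N) - sqrt (INR n))) by ring.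
  apply Rle_trans with (1 := Rabs_triang _ _).
  apply Rplus_le_compat; [exact hA|].
  rewrite Rabs_mult, (Rabs_pos_eq (_ - _)) by exact h1.
  apply Rmult_le_compat_l; [apply Rabs_pos|lra]. }
assert (hlim : forall e, is_lim_seq (fun n => x + e * / sqrt (INR n)) x).
{ intros e.
  replace (Finite x) with (Finite (x + e * 0)) by (f_equal; ring).
  apply is_lim_seq_plus'; [apply is_lim_seq_const|].
  apply (is_lim_seq_scal_l _ e (Finite 0)), is_lim_seq_inv_sqrt. }
apply is_lim_seq_le_le_loc with (2 := hlim (- D)) (3 := hlim D).
exists 1%nat; intros n hn.
assert (hs : 0 < sqrt (INR n)) by (apply sqrt_lt_R0, lt_0_INR; lia).
assert (hi := Rinv_0_lt_compat _ hs).
assert (hb := proj1 (Rabs_le_between _ _) (hD n)).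
replace (1 / sqrt (INR n) * sum_n_m eps 1 n) with
  (x + (sum_n_m eps 1 n - x * sqrt (INR n)) * / sqrt (INR n)) by (field; lra).
split; apply Rplus_le_compat_l, Rmult_le_compat_r; lra.
Qed.
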